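(* Let $r\ge0$ be an integer. As power series in $t$, $$\Big(\frac{1}{1-t}\Big)^{r}e^{x\big(\frac{1}{1-t}-1\big)}=\sum_{n=0}^{\infty}\mathrm{LB}_{n}^{(r)}(x)\frac{t^{n}}{n!}.$$
   Context: Falling factorials: $(x)_0=1$, $(x)_n=x(x-1)\cdots(x-n+1)$ for $n\ge1$. Rising factorials: $\langle x\rangle_0=1$, $\langle x\rangle_n=x(x+1)\cdots(x+n-1)$ for $n\ge 1$. For an integer $r\ge0$, the $r$-Lah numbers $L^r(n,k)$ ($0\le k\le n$) are defined by the polynomial identity $\langle x+r\rangle_n=\sum_{k=0}^n L^r(n,k)(x)_k$ for $n\ge0$. The $r$-Lah-Bell polynomials are $\mathrm{LB}_n^{(r)}(x)=\sum_{k=0}^n L^r(n,k)x^k$ for $n\ge0$. *)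

(* Defs.v *)
From HB Require Import structures.
From mathcomp Require Import all_boot all_order all_algebra.
From mathcomp Require Import boolp.

Set Implicit Arguments.
Unset Strict Implicit.
Unset Printing Implicit Defensive.

Import GRing.Theory.
Local Open Scope ring_scope.

(* FPS a is the formal power series \sum_n a_n t^n, with t = fpsX below. *)
Record fps (A : Type) := FPS { fps_coef :> nat -> A }.

HB.instance Definition _ (A : Type) := gen_eqMixin (fps A).
HB.instance Definition _ (A : Type) := gen_choiceMixin (fps A).

Lemma fpsP (A : Type) (f g : fps A) : (forall n, f n = g n) <-> f = g.
Proof.
split=> [|-> //]; case: f g => [f] [g] /= fg.
by congr FPS; apply: funext.
Qed.

Section FpsRing.
Variable A : comUnitRingType.
Implicit Types f g h : fps A.

Definition fps_zero : fps A := FPS (fun=> 0).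
Definition fps_opp f := FPS (fun n => - f n).
Definition fps_add f g := FPS (fun n => f n + g n).

Fact fps_addA : associative fps_add.
Proof. by move=> f g h; apply/fpsP => n /=; rewrite addrA. Qed.
Fact fps_addC : commutative fps_add.
Proof. by move=> f g; apply/fpsP => n /=; rewrite addrC. Qed.
Fact fps_add0 : left_id fps_zero fps_add.
Proof. by move=> f; apply/fpsP => n /=; rewrite add0r. Qed.
Fact fps_addN : left_inverse fps_zero fps_opp fps_add.
Proof. by move=> f; apply/fpsP => n /=; rewrite addNr. Qed.

HB.instance Definition _ := GRing.isZmodule.Build (fps A)
  fps_addA fps_addC fps_add0 fps_addN.

Definition fps_one : fps A := FPS (fun n => (n == 0%N)%:R).
Definition fps_mul f g := FPS (fun n => \sum_(i < n.+1) f i * g (n - i)%N).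

Let tr n f : {poly A} := \poly_(i < n.+1) f i.

Let coef_tr n f i : (i <= n)%N -> (tr n f)`_i = f i.
Proof. by move=> le_in; rewrite coef_poly ltnS le_in. Qed.

Let fps_mulE n f g i : (i <= n)%N -> fps_mul f g i = (tr n f * tr n g)`_i.
Proof.
move=> le_in; rewrite coefM; apply: eq_bigr => j _.
by rewrite !coef_tr // ?(leq_trans (leq_subr _ _)) // (leq_trans _ le_in) // -ltnS.
Qed.

Fact fps_mulC : commutative fps_mul.
Proof. by move=> f g; apply/fpsP => n; rewrite !(@fps_mulE n) // mulrC. Qed.

Fact fps_mulA : associative fps_mul.
Proof.
have E f g h n : fps_mul f (fps_mul g h) n = (tr n f * (tr n g * tr n h))`_n.
  rewrite coefM; apply: eq_bigr => j _.
  by rewrite -fps_mulE ?leq_subr // coef_tr // -ltnS.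
move=> f g h; apply/fpsP => n.
by rewrite [in RHS]fps_mulC !E mulrA mulrC.
Qed.

Fact fps_mul1 : left_id fps_one fps_mul.
Proof.
move=> f; apply/fpsP => n /=.
by rewrite big_ord_recl /= mul1r subn0 big1 ?addr0 // => i _; rewrite mul0r.
Qed.

Fact fps_mulDl : left_distributive fps_mul fps_add.
Proof.
move=> f g h; apply/fpsP => n /=.
by rewrite -big_split; apply: eq_bigr => i _; rewrite mulrDl.
Qed.

Fact fps_one_neq0 : fps_one != 0.
Proof. by apply/eqP => /fpsP /(_ 0%N) /= /eqP; rewrite oner_eq0. Qed.

HB.instance Definition _ := GRing.Zmodule_isComNzRing.Build (fps A)
  fps_mulA fps_mulC fps_mul1 fps_mulDl fps_one_neq0.

Definition fps_scale (a : A) f := FPS (fun n => a * f n).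

Fact fps_scaleA a b f : fps_scale a (fps_scale b f) = fps_scale (a * b) f.
Proof. by apply/fpsP => n /=; rewrite mulrA. Qed.
Fact fps_scale1 : left_id 1 fps_scale.
Proof. by move=> f; apply/fpsP => n /=; rewrite mul1r. Qed.
Fact fps_scaleDr : right_distributive fps_scale +%R.
Proof. by move=> a f g; apply/fpsP => n /=; rewrite mulrDr. Qed.
Fact fps_scaleDl f : {morph fps_scale^~ f : a b / a + b}.
Proof. by move=> a b; apply/fpsP => n /=; rewrite mulrDl. Qed.

HB.instance Definition _ := GRing.Zmodule_isLmodule.Build A (fps A)
  fps_scaleA fps_scale1 fps_scaleDr fps_scaleDl.

Lemma coef_fpsD f g n : (f + g) n = f n + g n. Proof. by []. Qed.
Lemma coef_fpsN f n : (- f) n = - f n. Proof. by []. Qed.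
Lemma coef_fpsB f g n : (f - g) n = f n - g n. Proof. by []. Qed.
Lemma coef_fps0 n : (0 : fps A) n = 0. Proof. by []. Qed.
Lemma coef_fps1 n : (1 : fps A) n = (n == 0%N)%:R. Proof. by []. Qed.
Lemma coef_fpsZ a f n : (a *: f) n = a * f n. Proof. by []. Qed.
Lemma coef_fpsM f g n : (f * g) n = \sum_(i < n.+1) f i * g (n - i)%N.
Proof. by []. Qed.
Lemma coef_fps_sum (I : Type) (s : seq I) (P : pred I) (F : I -> fps A) n :
  (\sum_(i <- s | P i) F i) n = \sum_(i <- s | P i) F i n.
Proof. exact: (big_morph (fun f : fps A => f n)). Qed.

Fact fps_scaleAl a f g : a *: (f * g) = (a *: f) * g.
Proof.
apply/fpsP => n; rewrite coef_fpsZ !coef_fpsM mulr_sumr.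
by apply: eq_bigr => i _; rewrite coef_fpsZ mulrA.
Qed.

Lemma coef_fpsX_small h k n : h 0%N = 0 -> (n < k)%N -> (h ^+ k) n = 0.
Proof.
move=> h0; elim: k n => // k IHk n lt_nk.
rewrite exprS coef_fpsM big_ord_recl h0 mul0r add0r big1 // => i _.
rewrite IHk ?mulr0 //= /bump add1n.
have lt_in := ltn_ord i.
by rewrite -ltnS (leq_trans _ lt_nk) // ltnS ltn_subrL (leq_trans _ lt_in).
Qed.

(* The substitution f(g(t)). It is meaningful only when g has constant
   coefficient 0: then t^k divides g^k, so no term of the infinite sum of the
   f_k g^k with k > n contributes to the coefficient of t^n. *)
Definition fps_comp f g : fps A := FPS (fun n => \sum_(k < n.+1) f k * (g ^+ k) n).

Definition fps_geom : fps A := FPS (fun=> 1).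

Lemma fps_comp_geomE h : h 0%N = 0 -> fps_comp fps_geom h * (1 - h) = 1.
Proof.
move=> h0; apply/fpsP => n.
have E i : (i <= n)%N -> fps_comp fps_geom h i = (\sum_(k < n.+1) h ^+ k) i.
  move=> le_in; rewrite coef_fps_sum /=.
  rewrite (big_ord_widen n.+1 (fun k => 1 * (h ^+ k) i)) // big_mkcond /=.
  apply: eq_bigr => k _; rewrite mul1r; case: ltnP => // lt_ik.
  by rewrite coef_fpsX_small.
transitivity (((\sum_(k < n.+1) h ^+ k) * (1 - h)) n).
  by rewrite !coef_fpsM; apply: eq_bigr => i _; rewrite E // -ltnS.
have := subrX1 h n.+1; move/(congr1 -%R); rewrite opprB -mulNr opprB mulrC => <-.
by rewrite coef_fpsB coef_fpsX_small // subr0.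
Qed.

Definition fps_unit : {pred fps A} := [pred f : fps A | f 0%N \is a GRing.unit].
Definition fps_inv f : fps A :=
  if f \in fps_unit
  then (f 0%N)^-1 *: fps_comp fps_geom (1 - (f 0%N)^-1 *: f) else f.

Fact fps_mulVx : {in fps_unit, left_inverse 1 fps_inv *%R}.
Proof.
move=> f uf; rewrite /fps_inv uf; rewrite inE /= in uf.
set h := 1 - _.
have h0 : h 0%N = 0 by rewrite coef_fpsB coef_fpsZ mulVr // subrr.
have -> : f = f 0%N *: (1 - h) by rewrite /h subKr scalerA mulrV // scale1r.
rewrite -/h mulrC -fps_scaleAl mulrC -fps_scaleAl !scalerA coef_fpsZ coef_fpsB h0.
by rewrite subr0 mulr1 mulrV // scale1r fps_comp_geomE.
Qed.

Fact fps_unitPl f g : g * f = 1 -> fps_unit f.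
Proof.
move=> /fpsP /(_ 0%N); rewrite coef_fpsM big_ord1 coef_fps1 /= => gf1.
by apply/unitrPr; exists (g 0%N); rewrite mulrC.
Qed.

Fact fps_invr_out : {in [predC fps_unit], fps_inv =1 id}.
Proof. by move=> f; rewrite inE /= /fps_inv => /negbTE ->. Qed.

HB.instance Definition _ := GRing.ComNzRing_hasMulInverse.Build (fps A)
  fps_mulVx fps_unitPl fps_invr_out.

Definition fpsX : fps A := FPS (fun n => (n == 1%N)%:R).

Definition fps_exp : fps A := FPS (fun n => (n`!%:R)^-1).

End FpsRing.

Arguments fpsX {A}.
Arguments fps_exp {A}.

Definition falling (R : comNzRingType) (x : R) (n : nat) : R :=
  \prod_(i < n) (x - i%:R).

Definition rising (R : comNzRingType) (x : R) (n : nat) : R :=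
  \prod_(i < n) (x + i%:R).

Lemma falling_monic n : falling ('X : {poly int}) n \is monic.
Proof. by apply: monic_prod => i _; rewrite -polyC_natr monicXsubC. Qed.

Lemma size_falling n : size (falling ('X : {poly int}) n) = n.+1.
Proof.
rewrite /falling; under eq_bigr do rewrite -polyC_natr.
by rewrite size_prod_XsubC /index_enum -enumT size_enum_ord.
Qed.

Lemma size_rising (a n : nat) : size (rising ('X + a%:R : {poly int}) n) = n.+1.
Proof.
rewrite /rising.
under eq_bigr => i _ do rewrite -addrA -natrD -polyC_natr -[_%:P]opprK -polyCN.
by rewrite size_prod_XsubC /index_enum -enumT size_enum_ord.
Qed.

Lemma falling_basis n (p : {poly int}) : (size p <= n)%N ->
  exists c : nat -> int, p = \sum_(k < n) (c k)%:P * falling 'X k.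
Proof.
elim: n p => [|n IHn] p sz_p.
  by exists (fun=> 0); rewrite big_ord0; apply/eqP; rewrite -size_poly_eq0 -leqn0.
have /IHn [c Ec] : (size (p - (p`_n)%:P * falling 'X n)%R <= n)%N.
  apply/leq_sizeP => j; rewrite leq_eqVlt => /orP[/eqP <-|lt_nj].
    rewrite coefB coefCM.
    have := monicP (falling_monic n); rewrite /lead_coef size_falling /= => ->.
    by rewrite mulr1 subrr.
  have ff0 : (falling ('X : {poly int}) n)`_j = 0.
    by rewrite nth_default // size_falling.
  by rewrite coefB coefCM ff0 mulr0 subr0; apply/leq_sizeP: lt_nj.
exists (fun k => if (k < n)%N then c k else p`_n).
rewrite big_ord_recr /= ltnn.
under eq_bigr do rewrite ltn_ord.
by rewrite -Ec subrK.
Qed.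

Lemma falling_free n (c d : nat -> int) :
  \sum_(k < n) (c k)%:P * falling ('X : {poly int}) k
    = \sum_(k < n) (d k)%:P * falling 'X k ->
  forall k, (k < n)%N -> c k = d k.
Proof.
elim: n => // n IHn; rewrite !big_ord_recr /= => E.
have small (e : nat -> int) :
    (\sum_(k < n) (e k)%:P * falling ('X : {poly int}) k)`_n = 0.
  rewrite coef_sum big1 // => i _; rewrite coefCM nth_default ?mulr0 //.
  by rewrite size_falling.
have Ecd : c n = d n.
  have := congr1 (fun p : {poly int} => p`_n) E.
  rewrite !coefD !small !coefCM !add0r.
  have := monicP (falling_monic n); rewrite /lead_coef size_falling /= => ->.
  by rewrite !mulr1.
move: E; rewrite Ecd => /addIr /IHn IH k.
by rewrite ltnS leq_eqVlt => /orP[/eqP -> //|/IH].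
Qed.

Lemma rLah_exists (r n : nat) : exists L : {ffun 'I_n.+1 -> int},
  rising ('X + r%:R : {poly int}) n == \sum_(k < n.+1) (L k)%:P * falling 'X k.
Proof.
have [|c Ec] := @falling_basis n.+1 (rising ('X + r%:R) n).
  by rewrite size_rising.
exists [ffun k : 'I_n.+1 => c k]; rewrite {1}Ec.
by apply/eqP/eq_bigr => k _; rewrite ffunE.
Qed.

(* The coordinates of <X + r>_n in the basis of falling factorials of X, i.e.
   the coefficients in its defining identity; the lemmas rLahE and rLah_unique
   say that this identity holds and determines them. *)
Definition rLah (r n : nat) : {ffun 'I_n.+1 -> int} := xchoose (rLah_exists r n).

Lemma rLahE r n :
  rising ('X + r%:R : {poly int}) n
    = \sum_(k < n.+1) (rLah r n k)%:P * falling 'X k.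
Proof. exact/eqP/(xchooseP (rLah_exists r n)). Qed.

Lemma rLah_unique r n (L : {ffun 'I_n.+1 -> int}) :
  rising ('X + r%:R : {poly int}) n = \sum_(k < n.+1) (L k)%:P * falling 'X k ->
  L = rLah r n.
Proof.
move=> E; have := E; rewrite rLahE => E2.
pose ext (M : {ffun 'I_n.+1 -> int}) (k : nat) : int := M (inord k).
have extE (M : {ffun 'I_n.+1 -> int}) : \sum_(k < n.+1) (M k)%:P * falling ('X : {poly int}) k
    = \sum_(k < n.+1) (ext M k)%:P * falling 'X k.
  by apply: eq_bigr => k _; rewrite /ext inord_val.
move: E2; rewrite !extE => /falling_free H.
by apply/ffunP => k; apply/esym; have := H k (ltn_ord k); rewrite /ext inord_val.
Qed.

(* The value at x of the r-Lah-Bell polynomial; at x := 'X it is the polynomial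
   itself. *)
Definition rLahBell (A : comNzRingType) (r n : nat) (x : A) : A :=
  \sum_(k < n.+1) (rLah r n k)%:~R * x ^+ k.

(* Main.v *)
Require Import Defs.
From mathcomp Require Import all_boot all_order all_algebra.

Import GRing.Theory.
Local Open Scope ring_scope.

(** Write G = 1/(1-t). Since n! [t^n] G^p = <p>_n, expanding
    G^(m+r) = G^r (1 + (G - 1))^m by the binomial theorem gives
    <m+r>_n = \sum_k 'C(m,k) n! [t^n] (G^r (G-1)^k) for every natural m. The
    defining identity of the r-Lah numbers, evaluated at m, reads
    <m+r>_n = \sum_k 'C(m,k) k! L^r(n,k). Binomial inversion then yields
    k! L^r(n,k) = n! [t^n] (G^r (G-1)^k), which is the coefficientwise form of
    the theorem. *)

Section FpsComplements.
Context {A : comUnitRingType}.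
Implicit Types f g h : fps A.

Lemma coef_fps_mulXS f n : (fpsX * f) n.+1 = f n.
Proof.
rewrite coef_fpsM !big_ord_recl /= mul0r add0r mul1r subSS subn0.
by rewrite big1 ?addr0 // => i _; rewrite mul0r.
Qed.

Lemma coef0_fps_mulX f : (fpsX * f) 0%N = 0.
Proof. by rewrite coef_fpsM big_ord1 /= mul0r. Qed.

Lemma fps_mul1subX_geom : (1 - fpsX) * fps_geom A = 1.
Proof.
apply/fpsP => -[|n]; rewrite mulrBl mul1r coef_fpsB.
  by rewrite coef0_fps_mulX subr0.
by rewrite coef_fps_mulXS subrr.
Qed.

Lemma fps_div1subX : 1 / (1 - fpsX) = fps_geom A.
Proof.
have uX : (1 - fpsX : fps A) \is a GRing.unit.
  by apply/unitrPr; exists (fps_geom A); apply: fps_mul1subX_geom.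
by apply: (mulrI uX); rewrite fps_mul1subX_geom mulrC divrK.
Qed.

Lemma coef_fpsMn f c n : (f *+ c) n = f n *+ c.
Proof. by elim: c => [|c IHc] //; rewrite !mulrS coef_fpsD IHc. Qed.

Lemma fps_scaleAr a f g : f * (a *: g) = a *: (f * g).
Proof. by rewrite mulrC -fps_scaleAl mulrC. Qed.

Lemma fps_exprZn a f n : (a *: f) ^+ n = a ^+ n *: f ^+ n.
Proof.
elim: n => [|n IHn]; first by rewrite !expr0 scale1r.
by rewrite !exprS IHn -fps_scaleAl fps_scaleAr scalerA.
Qed.

(** As [h ^+ k] has no terms below t^k, the inner sum for each coefficient i <= n can be extended to
    the common bound n, and the two sums then commute. *)
Lemma coef_fpsM_comp f g h n : h 0%N = 0 ->
  (f * fps_comp g h) n = \sum_(k < n.+1) g k * (f * h ^+ k) n.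
Proof.
move=> h0.
have compE i : (i <= n)%N ->
    fps_comp g h i = \sum_(k < n.+1) g k * (h ^+ k) i.
  move=> le_in /=.
  rewrite (big_ord_widen n.+1 (fun k => g k * (h ^+ k) i)) // big_mkcond /=.
  apply: eq_bigr => k _; case: ltnP => // lt_ik.
  by rewrite coef_fpsX_small // mulr0.
rewrite coef_fpsM.
under eq_bigr => i _ do rewrite compE ?leq_subr // mulr_sumr.
rewrite exchange_big /=; apply: eq_bigr => k _.
by rewrite mulr_sumr; apply: eq_bigr => i _; rewrite mulrCA.
Qed.

(** Double induction: (1-t) G^(p+1) = G^p gives a recurrence for the coefficients, which closes by
    <p>_(n+1) + (n+1) <p+1>_n = (p+n+1) <p+1>_n = <p+1>_(n+1). *)
Lemma coef_fps_geomX p n : n`!%:R * (fps_geom A ^+ p) n = rising p%:R n.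
Proof.
have coef0 q : (fps_geom A ^+ q) 0%N = 1.
  elim: q => [|q IHq]; first by rewrite expr0 coef_fps1.
  by rewrite exprS coef_fpsM big_ord1 IHq mulr1.
elim: p n => [|p IHp] n.
  rewrite expr0 coef_fps1; case: n => [|n]; first by rewrite mulr1 /rising big_ord0.
  by rewrite mulr0 /rising big_ord_recl mulr0n addr0 mul0r.
elim: n => [|n IHn]; first by rewrite coef0 mulr1 /rising big_ord0.
have geomS : (fps_geom A ^+ p.+1) n.+1
    = (fps_geom A ^+ p) n.+1 + (fps_geom A ^+ p.+1) n.
  have : (1 - fpsX) * fps_geom A ^+ p.+1 = fps_geom A ^+ p.
    by rewrite exprS mulrA fps_mul1subX_geom mul1r.
  move=> <-.
  by rewrite mulrBl mul1r coef_fpsB coef_fps_mulXS subrK.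
have risingS : rising (p%:R : A) n.+1 = p%:R * rising p.+1%:R n.
  rewrite /rising big_ord_recl addr0; congr (_ * _); apply: eq_bigr => i _.
  by rewrite -!natrD lift0 addnS.
rewrite geomS mulrDr IHp risingS factS natrM -mulrA IHn -mulrDl.
by rewrite /rising big_ord_recr /= mulrC -!natrD addSnnS.
Qed.

End FpsComplements.

(** The system is unitriangular: equation m contains [u m] with coefficient 1 and otherwise only
    smaller indices, so strong induction needs no division. *)
Lemma binomial_transform_inj {V : zmodType} n (u v : nat -> V) :
  (forall m, (m <= n)%N ->
     \sum_(k < m.+1) u k *+ 'C(m, k) = \sum_(k < m.+1) v k *+ 'C(m, k)) ->
  forall k, (k <= n)%N -> u k = v k.
Proof.
move=> uv k; elim/ltn_ind: k => k IHk le_kn.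
have := uv k le_kn; rewrite !big_ord_recr /= binn.
under eq_bigr => i _ do rewrite IHk ?(leq_trans (ltnW (ltn_ord i)) le_kn) //.
exact: addrI.
Qed.

Lemma falling_nat (R : comNzRingType) m k :
  falling (m%:R : R) k = (m ^_ k)%:R.
Proof.
elim: k => [|k IHk]; first by rewrite /falling big_ord0.
rewrite /falling big_ord_recr /= -/(falling _ _) IHk ffactnSr natrM.
(* For m < k the natural subtraction m - k truncates, but the factor [m ^_ k] is already 0. *)
by case: (leqP k m) => [/natrB -> //|lt_mk]; rewrite ffact_small // !mul0r.
Qed.

Lemma rising_rLah_nat (A : comNzRingType) r n m :
  rising ((m + r)%:R : A) n
    = \sum_(k < n.+1) (rLah r n k)%:~R * (m ^_ k)%:R.
Proof.
have := congr1 (fun p : {poly int} => (p.[m%:R])%:~R : A) (rLahE r n).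
rewrite /rising horner_prod horner_sum rmorph_prod rmorph_sum /= => E.
transitivity (\prod_(i < n) (('X + r%:R + i%:R : {poly int}).[m%:R])%:~R : A).
  apply: eq_bigr => i _.
  by rewrite -!polyC_natr !hornerE natrD !rmorphD /= !rmorph_nat.
rewrite E; apply: eq_bigr => k _.
rewrite hornerM hornerC rmorphM /=; congr (_ * _).
transitivity (((m ^_ k)%:R : int)%:~R : A); last by rewrite rmorph_nat.
rewrite -falling_nat /falling horner_prod; congr (_%:~R); apply: eq_bigr => i _.
by rewrite -polyC_natr !hornerE.
Qed.

Lemma rLah_fact_coef (A : comUnitRingType) r n (k : 'I_n.+1) :
  (rLah r n k)%:~R * k`!%:R
    = n`!%:R * (fps_geom A ^+ r * (fps_geom A - 1) ^+ k) n.
Proof.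
pose u k : A := (rLah r n (inord k))%:~R * k`!%:R.
pose v k : A := n`!%:R * (fps_geom A ^+ r * (fps_geom A - 1) ^+ k) n.
suff uv : u k = v k by rewrite -/(v k) -uv /u inord_val.
apply: (@binomial_transform_inj _ n); last by rewrite -ltnS.
move=> m le_mn; transitivity (rising ((m + r)%:R : A) n).
  rewrite rising_rLah_nat.
  (* Padding the sum up to n is harmless: [m ^_ k] vanishes for k > m. *)
  rewrite (big_ord_widen n.+1 (fun k => u k *+ 'C(m, k))) // big_mkcond /=.
  apply: eq_bigr => i _; case: ltnP => [le_im|lt_mi].
    by rewrite /u inord_val -bin_ffact mulnC mulrnA -mulrnAr.
  by rewrite ffact_small // mulr0.
have geomX : fps_geom A ^+ m
    = \sum_(i < m.+1) (fps_geom A - 1) ^+ i *+ 'C(m, i).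
  rewrite -{1}(subrK 1 (fps_geom A)) addrC exprDn.
  by apply: eq_bigr => i _; rewrite expr1n mul1r.
rewrite -coef_fps_geomX addnC exprD geomX [_ ^+ r * _]mulr_sumr coef_fps_sum mulr_sumr.
by apply: eq_bigr => i _; rewrite mulrnAr coef_fpsMn mulrnAr.
Qed.

(* The coefficients are in an arbitrary commutative Q-algebra A: taking
   A := {poly rat} and x := 'X makes x an indeterminate, taking A to be a field
   of characteristic 0 makes it a number. *)
Theorem mainTheorem9 (A : comUnitRingType)
    (A_Qalg : forall n : nat, n.+1%:R \is a @GRing.unit A) (x : A) (r : nat) :
  (1 / (1 - fpsX)) ^+ r * fps_comp fps_exp (x *: (1 / (1 - fpsX) - 1))
  = FPS (fun n : nat => rLahBell r n x / n`!%:R).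
Proof.
have factU n : n`!%:R \is a @GRing.unit A by rewrite -(prednK (fact_gt0 n)).
rewrite fps_div1subX; apply/fpsP => n.
rewrite coef_fpsM_comp; last by rewrite coef_fpsZ coef_fpsB subrr mulr0.
rewrite -[RHS]/(rLahBell r n x / n`!%:R) /rLahBell mulr_suml.
(* The units n! and k! clear the denominators of both sides. *)
apply: eq_bigr => k _; apply: (mulrI (factU n)); apply: (mulrI (factU k)).
rewrite fps_exprZn fps_scaleAr coef_fpsZ.
rewrite [in RHS](mulrC n`!%:R) divrK // [n`!%:R * _]mulrCA mulVKr //.
by rewrite mulrCA -rLah_fact_coef mulrC mulrAC mulrC.
Qed.
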